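(* Let $M=(E,r)$ be a $q$-matroid with $r(E)\ge 1$ and family of independent spaces $\mathcal{I}$. Then the family $\mathcal{I}_\tau=\{I\in\mathcal{I}:\dim I<r(E)\}$ is the family of independent spaces of a $q$-matroid on $E$ (the truncation $\tau(M)$); that is, $\mathcal{I}_\tau$ satisfies: (I1) $\mathcal{I}_\tau\neq\emptyset$; (I2) if $J\in\mathcal{I}_\tau$ and $I\subseteq J$ is a subspace, then $I\in\mathcal{I}_\tau$; (I3) if $I,J\in\mathcal{I}_\tau$ with $\dim I<\dim J$, then there is a $1$-dimensional subspace $x\subseteq J$, $x\not\subseteq I$, with $I+x\in\mathcal{I}_\tau$; (I4) for all subspaces $A,B\subseteq E$ and maximal (with respect to inclusion) members $I$ of $\mathcal{I}_\tau$ contained in $A$ and $J$ of $\mathcal{I}_\tau$ contained in $B$, there is a maximal member of $\mathcal{I}_\tau$ contained in $A+B$ which is contained in $I+J$.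
   Context: A $q$-matroid is a pair $(E,r)$ where $E$ is a finite dimensional vector space over a field and $r$ is an integer-valued function on the subspaces of $E$ such that for all subspaces $A,B$: (r1) $0\le r(A)\le \dim A$; (r2) if $A\subseteq B$ then $r(A)\le r(B)$; (r3) $r(A+B)+r(A\cap B)\le r(A)+r(B)$. A subspace $A$ is independent if $r(A)=\dim A$. A family of subspaces satisfying (I1)–(I4) is exactly the family of independent spaces of a unique $q$-matroid on $E$. *)

(* Defs.v *)
From HB Require Import structures.
From mathcomp Require Import all_boot all_order all_algebra.
Set Implicit Arguments.
Unset Strict Implicit.
Unset Printing Implicit Defensive.
Import Order.TTheory GRing.Theory Num.Theory.
Local Open Scope ring_scope.

(* The ground space is the whole vectType E, i.e. the subspace fullv. *)
Record qmatroid (K : fieldType) (E : vectType K) := QMatroid {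
  qrank :> {vspace E} -> int;
  qrank_ge0 : forall A : {vspace E}, 0 <= qrank A;
  qrank_le_dim : forall A : {vspace E}, qrank A <= (\dim A)%:Z;
  qrank_mono : forall A B : {vspace E}, (A <= B)%VS -> qrank A <= qrank B;
  qrank_submod : forall A B : {vspace E},
    qrank (A + B)%VS + qrank (A :&: B)%VS <= qrank A + qrank B
}.

Section Families.
Variables (K : fieldType) (E : vectType K).
Implicit Types (M : qmatroid E) (F : pred {vspace E}) (A B I J x : {vspace E}).

Definition indep M : pred {vspace E} := [pred A | M A == (\dim A)%:Z].

Definition trunc_indep M : pred {vspace E} :=
  [pred I | (I \in indep M) && ((\dim I)%:Z < M fullv)].

Definition maximal_in F A I : Prop :=
  [/\ I \in F, (I <= A)%VS
    & forall J, J \in F -> (J <= A)%VS -> (I <= J)%VS -> J = I].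

Definition axiom_I1 F : Prop := exists I, I \in F.

Definition axiom_I2 F : Prop :=
  forall I J, J \in F -> (I <= J)%VS -> I \in F.

Definition axiom_I3 F : Prop :=
  forall I J, I \in F -> J \in F -> (\dim I < \dim J)%N ->
    exists x, [/\ \dim x = 1%N, (x <= J)%VS, ~~ (x <= I)%VS
                & (I + x)%VS \in F].

Definition axiom_I4 F : Prop :=
  forall A B I J, maximal_in F A I -> maximal_in F B J ->
    exists L, maximal_in F (A + B)%VS L /\ (L <= I + J)%VS.

End Families.

(* Main.v *)
Require Import Defs.
From HB Require Import structures.
From mathcomp Require Import all_boot all_order all_algebra.
From mathcomp Require Import zify.
Set Implicit Arguments.
Unset Strict Implicit.
Unset Printing Implicit Defensive.
Import Order.TTheory GRing.Theory Num.Theory.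
Local Open Scope ring_scope.

(** The truncation has rank function [min (r A) (r E - 1)], which is again
    submodular because [r] is monotone, and its independent spaces are exactly
    the independent spaces of dimension less than [r E]. So it suffices to show
    that the independent spaces of an arbitrary q-matroid satisfy (I1)-(I4).
    Submodularity shows that adjoining a fixed subspace preserves equality of
    ranks of nested spaces. Hence an independent [I] whose rank is not increased
    by any vector of a basis of [A] satisfies [r (I + A) = r I]; this yields
    augmentation, and identifies the maximal independent subspaces of [A] with
    the independent [I <= A] such that [r I = r A]. *)

Section IndependentSpaces.
Variables (K : fieldType) (E : vectType K) (M : qmatroid E).
Implicit Types (A B C I J : {vspace E}) (v : E).

Lemma indepE A : (A \in indep M) = (M A == (\dim A)%:Z).
Proof. by []. Qed.

Lemma qrank_add_le A B : M (A + B)%VS <= M A + (\dim B)%:Z.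
Proof.
have := qrank_submod M A B; have := qrank_ge0 M (A :&: B)%VS.
have := qrank_le_dim M B; lia.
Qed.

(** Submodularity for [A] and [I + C]: their sum is [A + C], and their intersection contains [I]. *)
Lemma qrank_add_le_of_eq I A C :
  (I <= A)%VS -> M A <= M I -> M (A + C)%VS <= M (I + C)%VS.
Proof.
move=> sIA rAI; have := qrank_submod M A (I + C)%VS.
rewrite addvA (addv_idPl sIA).
have : M I <= M (A :&: (I + C))%VS by rewrite qrank_mono// subv_cap sIA addvSl.
lia.
Qed.

Lemma qrank_add_span_le I (s : seq E) :
  all (fun v => M (I + <[v]>)%VS <= M I) s -> M (I + <<s>>)%VS <= M I.
Proof.
elim: s => [|v s IHs] /=; first by rewrite span_nil addv0.
case/andP=> rIv /IHs; apply: le_trans.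
by rewrite span_cons addvA; apply: qrank_add_le_of_eq; first exact: addvSl.
Qed.

Lemma indep0 : 0%VS \in indep M.
Proof.
have := qrank_le_dim M 0%VS; have := qrank_ge0 M 0%VS.
by rewrite indepE dimv0; lia.
Qed.

(** Adjoining a complement of [I] in [J] raises the rank by at most [\dim J - \dim I], so
    [M J = \dim J] forces [M I >= \dim I]. *)
Lemma indep_sub I J : J \in indep M -> (I <= J)%VS -> I \in indep M.
Proof.
rewrite !indepE => /eqP rJ sIJ; have := qrank_add_le I (J :\: I)%VS.
have := qrank_le_dim M I; have := dimv_cap_compl J I.
by rewrite (addvC I) addv_diff (addv_idPl sIJ) (capv_idPr sIJ) rJ; lia.
Qed.

Lemma indep_augment I A : I \in indep M -> M I < M A ->
  exists2 v, v \in A & v \notin I /\ (I + <[v]>)%VS \in indep M.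
Proof.
rewrite indepE => /eqP rI ltIA.
have [rIA | /allPn[v vA]] :=
  boolP (all (fun v => M (I + <[v]>)%VS <= M I) (vbasis A)).
  have := qrank_add_span_le rIA; rewrite (span_basis (vbasisP A)).
  by have := qrank_mono M (addvSr I A); lia.
rewrite -ltNge => rIv; exists v; first exact: vbasis_mem vA.
split; first by apply/negP => vI; move: rIv; rewrite (addv_idPl vI) ltxx.
(* The rank of [I + <[v]>] exceeds [\dim I], while its dimension is at most [\dim I + 1]; so the two
   agree. *)
have := qrank_le_dim M (I + <[v]>)%VS; have := dim_vline v.
by have := dimv_add_leqif I <[v]>; rewrite indepE => -[]; lia.
Qed.

Lemma maximal_indepP I A :
  maximal_in (indep M) A I <-> [/\ I \in indep M, (I <= A)%VS & M I = M A].
Proof.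
split=> [[indI sIA maxI] | [indI sIA rIA]]; split=> //.
  apply/eqP; rewrite eq_le qrank_mono//= leNgt; apply/negP.
  case/(indep_augment indI) => v vA [/negP vI /maxI eqI]; apply: vI.
  have <- : (I + <[v]>)%VS = I by apply: eqI; rewrite ?addvSl// subv_add sIA.
  exact: addvSr.
(* Here [\dim J = M J <= M A = M I = \dim I]. *)
move=> J indJ sJA sIJ; apply/eqP; rewrite eq_sym eqEdim sIJ /=.
move: indI indJ; rewrite !indepE => /eqP rI /eqP rJ.
by have := qrank_mono M sJA; lia.
Qed.

Lemma exists_maximal_indep A : exists I, maximal_in (indep M) A I.
Proof.
(* Greedy augmentation from the zero space: [n] bounds the rank deficit, which drops with each added
   vector. *)
suff: forall n I, I \in indep M -> (I <= A)%VS -> M A <= M I + n%:Z ->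
    exists J, maximal_in (indep M) A J.
  move/(_ `|M A|%N 0%VS indep0 (sub0v A)); apply.
  by have := qrank_ge0 M 0%VS; lia.
elim=> [|n IHn] I indI sIA leAI.
  by exists I; apply/maximal_indepP; split=> //; have := qrank_mono M sIA; lia.
have [leAI'|ltIA] := leP (M A) (M I).
  by exists I; apply/maximal_indepP; split=> //; have := qrank_mono M sIA; lia.
have [v vA [vI indIv]] := indep_augment indI ltIA.
apply: (IHn _ indIv); first by rewrite subv_add sIA.
have : (\dim I < \dim (I + <[v]>))%N.
  rewrite ltnNge; apply: contra vI => leIv.
  have /eqP -> : I == (I + <[v]>)%VS by rewrite eqEdim addvSl.
  exact: addvSr.
by move: indI indIv; rewrite !indepE; lia.
Qed.

Lemma indep_I3 : axiom_I3 (indep M).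
Proof.
move=> I J indI indJ ltIJ.
have ltrIJ : M I < M J by move: indI indJ; rewrite !indepE; lia.
have [v vJ [vI indIv]] := indep_augment indI ltrIJ.
exists <[v]>%VS; split=> //.
by rewrite dim_vline; case: eqP vI => // ->; rewrite mem0v.
Qed.

Lemma indep_I4 : axiom_I4 (indep M).
Proof.
move=> A B I J /maximal_indepP[_ sIA rIA] /maximal_indepP[_ sJB rJB].
have [L /maximal_indepP[indL sL rL]] := exists_maximal_indep (I + J)%VS.
exists L; split=> //; apply/maximal_indepP.
have sIJ : (I + J <= A + B)%VS by exact: addvS.
split=> //; first exact: subv_trans sIJ.
apply/eqP; rewrite rL eq_le qrank_mono //=.
(* Exchange one summand at a time: [B] for [J], then [A] for [I]. *)
apply: (@le_trans _ _ (M (A + J)%VS)); last first.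
  by apply: qrank_add_le_of_eq; rewrite ?rIA.
by rewrite !(addvC A); apply: qrank_add_le_of_eq; rewrite ?rJB.
Qed.

End IndependentSpaces.

Section Truncation.
Variables (K : fieldType) (E : vectType K) (M : qmatroid E).
Hypothesis rank_gt0 : 1 <= M fullv.
Implicit Types A B : {vspace E}.

Definition trunc_rank A : int := Num.min (M A) (M fullv - 1).

(** The cap [M fullv - 1] is nonnegative by [rank_gt0]. *)
Lemma trunc_rank_ge0 A : 0 <= trunc_rank A.
Proof. by rewrite /trunc_rank; have := qrank_ge0 M A; lia. Qed.

Lemma trunc_rank_le_dim A : trunc_rank A <= (\dim A)%:Z.
Proof. by rewrite /trunc_rank; have := qrank_le_dim M A; lia. Qed.

Lemma trunc_rank_mono A B : (A <= B)%VS -> trunc_rank A <= trunc_rank B.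
Proof. by rewrite /trunc_rank => /(qrank_mono M); lia. Qed.

(** If [A] or [B] reaches the cap, so does [A + B], and monotonicity bounds the intersection term by
    the other summand. Otherwise the right side is untruncated and capping only lowers the left. *)
Lemma trunc_rank_submod A B :
  trunc_rank (A + B)%VS + trunc_rank (A :&: B)%VS
    <= trunc_rank A + trunc_rank B.
Proof.
rewrite /trunc_rank; have := qrank_submod M A B.
have := qrank_mono M (addvSl A B); have := qrank_mono M (addvSr A B).
by have := qrank_mono M (capvSl A B); have := qrank_mono M (capvSr A B); lia.
Qed.

Definition truncation : qmatroid E :=
  QMatroid trunc_rank_ge0 trunc_rank_le_dim trunc_rank_mono trunc_rank_submod.

Lemma indep_truncation : indep truncation =i trunc_indep M.
Proof.
move=> A; rewrite indepE [RHS]inE indepE /= /trunc_rank.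
have := qrank_le_dim M A; lia.
Qed.

End Truncation.

Lemma maximal_in_eq (K : fieldType) (E : vectType K)
    (F G : pred {vspace E}) A I :
  F =i G -> maximal_in F A I -> maximal_in G A I.
Proof.
move=> eqFG [FI sIA maxI]; split; rewrite -?eqFG // => J.
by rewrite -eqFG; exact: maxI.
Qed.

Theorem theorem5p2 (K : fieldType) (E : vectType K) (M : qmatroid E)
    (hM : 1 <= M fullv) :
  [/\ axiom_I1 (trunc_indep M), axiom_I2 (trunc_indep M),
      axiom_I3 (trunc_indep M) & axiom_I4 (trunc_indep M)] /\
  exists N : qmatroid E, indep N =i trunc_indep M.
Proof.
have eqN := indep_truncation hM.
split; last by exists (truncation hM).
split.
- by exists 0%VS; rewrite -eqN indep0.
- by move=> I J; rewrite -!eqN; exact: indep_sub.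
- move=> I J; rewrite -!eqN => indI indJ /(indep_I3 indI indJ)[x [dx sx nx ix]].
  by exists x; rewrite -eqN.
(* Maximality passes to the truncation and back, since it depends only on membership in the
   family. *)
- have eqN' := fsym eqN.
  move=> A B I J /(maximal_in_eq eqN') maxI /(maximal_in_eq eqN') maxJ.
  have [L [maxL sL]] := indep_I4 maxI maxJ.
  by exists L; split=> //; exact: maximal_in_eq maxL.
Qed.
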